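(* Let $$\tau(s,t)=\frac1s\left[t-(t+s+1)\left(\frac{t}{t+1}\right)^{s+1}\right]$$ for $(s,t)\in(0,\infty)\times(0,\infty)$, and let $\tau_0=\tau(s_0,t_0)>0$ be the maximum of $\tau(s,t)$ on the set $\mathbb{N}\times(0,\infty)$. Then for any given real number $\alpha$ satisfying $\alpha\le\frac{1}{1+\tau_0}<1$, the function $x\mapsto \dfrac{(x+1)^\alpha}{[\Gamma(x+1)]^{1/x}}$ is logarithmically completely monotonic on $(-1,\infty)$.
   Context: $\mathbb{N}=\{1,2,\dots\}$. A positive function $f$ on an interval $I$ is called logarithmically completely monotonic on $I$ if it has derivatives of all orders on $I$ and $(-1)^n[\ln f(x)]^{(n)}\ge 0$ for all $x\in I$ and all $n\in\mathbb{N}$. $\Gamma$ is the Euler gamma function. Convention: at $x=0$ the expression $[\Gamma(x+1)]^{1/x}$ is assigned its limiting value $e^{-\gamma}$, where $\gamma$ is the Euler–Mascheroni constant.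
   Formalization: The maximum τ_0=τ(s_0,t_0) of τ on N×(0,∞) is not attained at any (s_0,t_0); the formal theorem takes τ_0 to be the supremum (least upper bound) of τ on that set, and proves that it exists and is positive. *)

(* Defs.v *)
From Stdlib Require Import Reals.
From Coquelicot Require Import Coquelicot.
Open Scope R_scope.

(* Meaningful for [0 < x], where the improper integral converges. *)
Definition Gamma (x : R) : R :=
  RInt_gen (fun t => Rpower t (x - 1) * exp (- t))
    (at_right 0) (Rbar_locally p_infty).

(* [sum_f_R0 u n] has [n + 1] terms, so the n-th term of the sequence is
   1 + 1/2 + ... + 1/(n+1) - ln (n+1). *)
Definition euler_gamma : R :=
  real (Lim_seq (fun n => sum_f_R0 (fun k => / INR (S k)) n - ln (INR (S n)))).

(* Endpoints lie in the extended reals. The interval is open, so Coquelicot's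
   two-sided derivatives at its points are the intended ones. *)
Definition log_completely_monotonic (a b : Rbar) (f : R -> R) : Prop :=
  forall x : R, Rbar_lt a x -> Rbar_lt x b ->
    0 < f x /\
    (forall n : nat, ex_derive_n f n x) /\
    (forall n : nat, (1 <= n)%nat ->
       0 <= (-1) ^ n * Derive_n (fun y => ln (f y)) n x).

Definition tau (s t : R) : R :=
  / s * (t - (t + s + 1) * Rpower (t / (t + 1)) (s + 1)).

(* The "maximum" of tau over {1, 2, ...} x (0, oo) is to be read as the least
   upper bound of this set: max_t (tau s t) appears to increase strictly with s
   towards max_(u > 0) (u - (u + 1) * exp (- 1 / u)) = 0.2984..., in which case
   no pair (s, t) attains it. An attained maximum would be a least upper
   bound too. *)
Definition tau_values (v : R) : Prop :=
  exists (s : nat) (t : R), (1 <= s)%nat /\ 0 < t /\ v = tau (INR s) t.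

(* [Gamma (x + 1)] to the power [1 / x], extended by its limit at 0. *)
Definition Gamma_root (x : R) : R :=
  if Req_dec_T x 0 then exp (- euler_gamma)
  else Rpower (Gamma (x + 1)) (1 / x).

(* Main.v *)
Require Import Defs.
From Stdlib Require Import Reals Factorial Lra Lia.
From Coquelicot Require Import Coquelicot.
Open Scope R_scope.

(* Since ln (Gamma (x + 1)) = sum_(c >= 1) (x / c - ln (1 + x / c)) - gamma x,
   the logarithm of Gamma_root is smooth on (-1, oo) and, with
     K_n(c, x) = int_0^1 u^n / (c + x u)^(n+1) du,
   its n-th derivative is (-1)^(n+1) n! sum_(c >= 1) K_n(c, x). What has to be
   shown is n sum_c K_n(c, x) >= alpha / (1 + x)^n. The inequality
   tau(n, t) <= tau0 is a rearrangement of
     g(t) - g(t + 1) <= (1 + tau0) / t^(n+1),   g(t) = (t + n) / (n t^(n+1)).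
   Taking t = c + x u, integrating against u^n and summing over c telescopes to
   int_0^1 u^n g(1 + x u) du <= (1 + tau0) sum_c K_n(c, x), and the left-hand
   side is 1 / (n (1 + x)^n), because u^n g(1 + x u) is the derivative of
   u^(n+1) / (n (1 + x u)^n). *)

(** * The Gamma integral *)

(** [Gamma] is given only as an improper integral, so the series for its logarithm has to be
    derived: tangent-line bounds on powers of t under the integral give Gamma(N + x) ~ N^x Gamma(N),
    and the functional equation turns this asymptotic into the series. The exponent 1 / x threatens
    to make x = 0 a special point for every derivative. Writing (ln (c + x) - ln c) / x as the
    integral of 1 / (c + x u) over [0, 1] removes the singularity, and differentiating n times in x
    under the integral produces K_n up to the factor (-1)^n n!. The function g is found backwards,
    from a primitive that vanishes at u = 0 and takes the desired value at u = 1. That the factor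
    left beside u^n depends on u only through t = 1 + x u is what makes the shift from c to c + 1 a
    shift of t by 1. The constant is then forced, since t^(n+1) (g(t) - g(t + 1)) is exactly 1 +
    tau(n, t). *)

Notation is_RInt_0_oo f l :=
  (is_RInt_gen f (at_right 0) (Rbar_locally p_infty) l).

Lemma filter_prod_0_oo (P : R * R -> Prop) (a0 b0 : R) :
  0 < a0 -> (forall a b, 0 < a < a0 -> b0 < b -> P (a, b)) ->
  filter_prod (at_right 0) (Rbar_locally p_infty) P.
Proof.
intros ha H.
apply (Filter_prod _ _ _ (fun a => 0 < a < a0) (fun b => b0 < b)).
- exists (mkposreal a0 ha); intros y hy h0; split; [exact h0|].
  unfold ball in hy; simpl in hy; unfold AbsRing_ball, abs, minus, plus, opp in hy.
  simpl in hy; apply Rabs_def2 in hy; lra.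
- exists b0; auto.
- intros a b hA hB; apply H; auto.
Qed.

(** For a nonnegative integrand the integral grows with the interval, so the supremum over compact
    subintervals is the improper integral. The second conjunct later gives the positivity of
    [Gamma]. *)
Lemma is_RInt_0_oo_bounded (f : R -> R) (M : R) :
  (forall t, 0 < t -> 0 <= f t) ->
  (forall t, 0 < t -> continuous f t) ->
  (forall a b, 0 < a <= b -> RInt f a b <= M) ->
  exists l, is_RInt_0_oo f l /\ forall a b, 0 < a <= b -> RInt f a b <= l.
Proof.
intros f0 fc fM.
assert (fi : forall a b, 0 < a <= b -> ex_RInt f a b).
{ intros a b hab; apply (ex_RInt_continuous (V := R_CompleteNormedModule)).
  intros z hz; apply fc; rewrite Rmin_left in hz; lra. }
destruct (completeness (fun v => exists a b, 0 < a <= b /\ v = RInt f a b))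
  as [l [lub1 lub2]].
{ exists M; intros v [a [b [hab ->]]]; auto. }
{ exists (RInt f 1 1), 1, 1; split; [lra|reflexivity]. }
assert (le_l : forall a b, 0 < a <= b -> RInt f a b <= l).
{ intros a b hab; apply lub1; exists a, b; auto. }
exists l; split; [|exact le_l].
intros P [eps hP].
assert (hex : exists a0 b0, 0 < a0 <= b0 /\ l - eps < RInt f a0 b0).
{ apply Classical_Prop.NNPP; intro hn.
  assert (l <= l - eps); [|destruct eps; simpl in *; lra].
  apply lub2; intros v [a [b [hab ->]]].
  destruct (Rle_lt_dec (RInt f a b) (l - eps)) as [h|h]; [exact h|].
  exfalso; apply hn; exists a, b; auto. }
destruct hex as [a0 [b0 [hab h]]].
apply (filter_prod_0_oo _ a0 b0); [lra|]; intros a b ha hb; simpl.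
exists (RInt f a b); split.
{ apply (RInt_correct (V := R_CompleteNormedModule)), fi; lra. }
apply hP.
unfold ball; simpl; unfold AbsRing_ball, abs, minus, plus, opp; simpl.
assert (e1 : RInt f a b = RInt f a a0 + RInt f a0 b0 + RInt f b0 b).
{ rewrite <- (RInt_Chasles f a b0 b), <- (RInt_Chasles f a a0 b0);
    try (apply fi; lra); reflexivity. }
assert (0 <= RInt f a a0).
{ apply RInt_ge_0; [lra|apply fi; lra|intros; apply f0; lra]. }
assert (0 <= RInt f b0 b).
{ apply RInt_ge_0; [lra|apply fi; lra|intros; apply f0; lra]. }
assert (RInt f a b <= l) by (apply le_l; lra).
apply Rabs_def1; lra.
Qed.

(** Deduced from the norm inequality for improper integrals, which is why the smaller integrand is
    also required to be nonnegative. *)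
Lemma is_RInt_0_oo_le (f g : R -> R) (lf lg : R) :
  (forall t, 0 < t -> 0 <= f t <= g t) ->
  is_RInt_0_oo f lf -> is_RInt_0_oo g lg -> lf <= lg.
Proof.
intros fg hf hg.
assert (h : norm lf <= lg).
{ refine (RInt_gen_norm (V := R_CompleteNormedModule) f g lf lg _ _ hf hg).
  - apply (filter_prod_0_oo _ 1 1); [lra|]; simpl; intros; lra.
  - apply (filter_prod_0_oo _ 1 1); [lra|]; simpl; intros a b ha hb t ht.
    destruct (fg t); [lra|].
    unfold norm; simpl; unfold abs; simpl; rewrite Rabs_pos_eq; lra. }
apply Rle_trans with (2 := h), Rle_abs.
Qed.

Lemma is_RInt_0_oo_ext (f g : R -> R) (l : R) :
  (forall t, 0 < t -> f t = g t) -> is_RInt_0_oo f l -> is_RInt_0_oo g l.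
Proof.
intros fg; apply is_RInt_gen_ext; try apply _.
apply (filter_prod_0_oo _ 1 1); [lra|]; simpl; intros a b ha hb t ht.
apply fg; rewrite Rmin_left in ht; lra.
Qed.

Lemma is_RInt_0_oo_lin (f g : R -> R) (c d lf lg : R) :
  is_RInt_0_oo f lf -> is_RInt_0_oo g lg ->
  is_RInt_0_oo (fun t => c * f t + d * g t) (c * lf + d * lg).
Proof.
intros hf hg.
exact (is_RInt_gen_plus (V := R_NormedModule) _ _ _ _
  (is_RInt_gen_scal (V := R_NormedModule) _ c _ hf)
  (is_RInt_gen_scal (V := R_NormedModule) _ d _ hg)).
Qed.

Lemma is_RInt_0_oo_derive (F f : R -> R) (l0 l1 : R) :
  (forall t, 0 < t -> is_derive F t (f t)) ->
  (forall t, 0 < t -> continuous f t) ->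
  filterlim F (at_right 0) (locally l0) ->
  filterlim F (Rbar_locally p_infty) (locally l1) ->
  is_RInt_0_oo f (l1 - l0).
Proof.
intros hd hc h0 h1.
apply (is_RInt_0_oo_ext (Derive F)).
{ intros t ht; apply is_derive_unique, hd, ht. }
apply is_RInt_gen_Derive; auto; try apply _.
- apply (filter_prod_0_oo _ 1 1); [lra|]; simpl; intros a b ha hb t ht.
  exists (f t); apply hd; rewrite Rmin_left in ht; lra.
- apply (filter_prod_0_oo _ 1 1); [lra|]; simpl; intros a b ha hb t ht.
  rewrite Rmin_left in ht by lra.
  apply continuous_ext_loc with f; [|apply hc; lra].
  assert (h : 0 < t) by lra.
  exists (mkposreal t h); intros y hy; symmetry; apply is_derive_unique, hd.
  unfold ball in hy; simpl in hy; unfold AbsRing_ball, abs, minus, plus, opp in hy.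
  simpl in hy; apply Rabs_def2 in hy; lra.
Qed.

Lemma ln_le_tangent (p s : R) : 0 < p -> 0 < s -> ln s <= ln p + s / p - 1.
Proof.
intros hp hs.
assert (h := exp_ineq1_le (ln (s / p))).
rewrite exp_ln in h by (apply Rdiv_lt_0_compat; lra).
rewrite ln_div in h by lra; lra.
Qed.

Lemma exp_le (x y : R) : x <= y -> exp x <= exp y.
Proof.
intros [h| ->]; [left; apply exp_increasing, h|right; reflexivity].
Qed.

Lemma Rpower_exp_bounded (p : R) : 0 < p ->
  exists K, 0 < K /\ forall s, 0 < s -> Rpower s p * exp (- s) <= K.
Proof.
(* This is p^p e^(-p), the maximum, attained at s = p. *)
intros hp; exists (exp (p * ln p - p)); split; [apply exp_pos|].
intros s hs; unfold Rpower; rewrite <- exp_plus; apply exp_le.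
assert (h := ln_le_tangent p s hp hs).
apply Rmult_le_compat_l with (r := p) in h; [|lra].
replace (p * (ln p + s / p - 1)) with (p * ln p + s - p) in h by (field; lra).
lra.
Qed.

Lemma is_derive_Rpower (x t : R) : 0 < t ->
  is_derive (fun u => Rpower u x) t (x * Rpower t (x - 1)).
Proof. intros ht; apply is_derive_Reals, derivable_pt_lim_power, ht. Qed.

Lemma continuous_Rpower (x t : R) : 0 < t -> continuous (fun u => Rpower u x) t.
Proof.
intros ht; apply (ex_derive_continuous (V := R_NormedModule)).
eexists; apply is_derive_Rpower, ht.
Qed.

Definition gamma_integrand (x t : R) : R := Rpower t (x - 1) * exp (- t).

Lemma gamma_integrand_pos (x t : R) : 0 < gamma_integrand x t.
Proof. apply Rmult_lt_0_compat; apply exp_pos. Qed.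

Lemma continuous_exp_opp (t : R) : continuous (fun u => exp (- u)) t.
Proof.
apply (ex_derive_continuous (V := R_NormedModule)); auto_derive; auto.
Qed.

Lemma continuous_gamma_integrand (x t : R) :
  0 < t -> continuous (gamma_integrand x) t.
Proof.
intros ht; apply (continuous_mult (K := R_AbsRing)).
- apply continuous_Rpower, ht.
- apply continuous_exp_opp.
Qed.

(* The integrand is dominated by a multiple of the derivative of the bounded
   function (t / (1 + t))^x, which controls both ends of the interval. *)
Lemma RInt_gamma_integrand_bounded (x : R) : 0 < x ->
  exists M, forall a b, 0 < a <= b -> RInt (gamma_integrand x) a b <= M.
Proof.
intros hx.
destruct (Rpower_exp_bounded (x + 1)) as [K [hK0 hK]]; [lra|].
(* The derivative of (t / (1 + t))^x is x t^(x-1) / (1 + t)^(x+1). Since e^(-t) = e e^(-(1+t)) <= K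
   e / (1 + t)^(x+1), this C makes C times the derivative dominate the integrand. *)
set (C := K * exp 1 / x).
assert (hC : 0 < C).
{ unfold C; apply Rdiv_lt_0_compat; [|lra].
  apply Rmult_lt_0_compat; [lra|apply exp_pos]. }
set (F := fun t => C * Rpower (t / (1 + t)) x).
set (f := fun t => C * (/ ((1 + t) * (1 + t)) * (x * Rpower (t / (1 + t)) (x - 1)))).
assert (hd : forall t, 0 < t -> is_derive F t (f t)).
{ intros t ht; apply is_derive_scal.
  apply (is_derive_comp (V := R_NormedModule) (fun u => Rpower u x) (fun t => t / (1 + t))).
  - apply is_derive_Rpower, Rdiv_lt_0_compat; lra.
  - auto_derive; [lra|field; lra]. }
assert (hc : forall t, 0 < t -> continuous f t).
{ intros t ht; apply (continuous_scal_r (K := R_AbsRing) (V := R_NormedModule)).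
  apply (continuous_mult (K := R_AbsRing)).
  - apply (ex_derive_continuous (V := R_NormedModule)); auto_derive; nra.
  - apply (continuous_scal_r (K := R_AbsRing) (V := R_NormedModule)).
    apply (continuous_comp (fun t => t / (1 + t)) (fun u => Rpower u (x - 1))).
    + apply (ex_derive_continuous (V := R_NormedModule)); auto_derive; lra.
    + apply continuous_Rpower, Rdiv_lt_0_compat; lra. }
exists C; intros a b hab.
assert (hi : is_RInt f a b (F b - F a)).
{ apply (is_RInt_derive (V := R_CompleteNormedModule) F f);
    intros t ht; rewrite Rmin_left in ht by lra; [apply hd|apply hc]; lra. }
apply Rle_trans with (F b - F a).
- rewrite <- (is_RInt_unique _ _ _ _ hi).
  apply RInt_le; [lra| |eexists; exact hi|].
  { apply (ex_RInt_continuous (V := R_CompleteNormedModule)).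
    intros t ht; apply continuous_gamma_integrand.
    rewrite Rmin_left in ht; lra. }
  intros t ht; unfold f, C, gamma_integrand.
  assert (h := hK (1 + t) ltac:(lra)).
  replace (K * exp 1 / x * (/ ((1 + t) * (1 + t)) * (x * Rpower (t / (1 + t)) (x - 1))))
    with (Rpower t (x - 1) * (K * exp 1 / Rpower (1 + t) (x + 1))).
  + apply Rmult_le_compat_l; [left; apply exp_pos|].
    apply Rle_div_r; [apply exp_pos|].
    replace (exp (- t)) with (exp 1 * exp (- (1 + t)))
      by (rewrite <- exp_plus; f_equal; ring).
    assert (h1 := exp_pos 1); nra.
  + replace (x + 1) with ((x - 1) + INR 2) by (simpl; ring).
    rewrite Rpower_plus, (Rpower_pow 2) by lra.
    replace (Rpower t (x - 1)) with
      (Rpower (t / (1 + t)) (x - 1) * Rpower (1 + t) (x - 1)).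
    * field; repeat split; try lra. apply Rgt_not_eq, exp_pos.
    * rewrite Rpower_mult_distr; try (apply Rdiv_lt_0_compat); try lra.
      f_equal; field; lra.
- assert (0 < F a) by (apply Rmult_lt_0_compat; [lra|apply exp_pos]).
  assert (F b <= C * 1); [|lra].
  apply Rmult_le_compat_l; [lra|].
  apply Rle_trans with (exp 0); [apply exp_le|rewrite exp_0; lra].
  assert (ln (b / (1 + b)) < 0); [|nra].
  rewrite <- ln_1; apply ln_increasing; [apply Rdiv_lt_0_compat; lra|].
  apply Rlt_div_l; lra.
Qed.

Lemma Gamma_correct (x : R) : 0 < x ->
  is_RInt_0_oo (gamma_integrand x) (Gamma x) /\ 0 < Gamma x.
Proof.
intros hx.
destruct (RInt_gamma_integrand_bounded x hx) as [M hM].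
destruct (is_RInt_0_oo_bounded (gamma_integrand x) M) as [l [hl hle]]; auto.
{ intros; left; apply gamma_integrand_pos. }
{ intros; apply continuous_gamma_integrand; auto. }
assert (e : Gamma x = l).
{ unfold Gamma.
  refine (is_RInt_gen_unique (V := R_CompleteNormedModule) _ _ hl). }
rewrite e; split; [exact hl|].
apply Rlt_le_trans with (2 := hle 1 2 ltac:(lra)).
apply RInt_gt_0; [lra| |].
- intros; apply gamma_integrand_pos.
- intros; apply continuous_gamma_integrand; lra.
Qed.

Lemma Gamma_pos (x : R) : 0 < x -> 0 < Gamma x.
Proof. intros; apply Gamma_correct; auto. Qed.

(** * Boundary limits and the functional equation of Gamma *)

Lemma Rpower_exp_lim_0 (x : R) : 0 < x ->
  filterlim (fun t => Rpower t x * exp (- t)) (at_right 0) (locally 0).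
Proof.
intros hx; apply filterlim_locally; intros eps.
assert (hd : 0 < Rpower eps (/ x)) by apply exp_pos.
exists (mkposreal _ hd); intros t ht h0.
unfold ball in *; simpl in *; unfold AbsRing_ball, abs, minus, plus, opp in *.
simpl in *; rewrite Ropp_0, Rplus_0_r in *.
rewrite Rabs_pos_eq in ht by lra.
rewrite Rabs_pos_eq by (left; apply Rmult_lt_0_compat; apply exp_pos).
apply Rle_lt_trans with (Rpower t x * 1).
{ apply Rmult_le_compat_l; [left; apply exp_pos|].
  rewrite <- exp_0; apply exp_le; lra. }
rewrite Rmult_1_r.
apply Rlt_le_trans with (Rpower (Rpower eps (/ x)) x).
- apply Rlt_Rpower_l; lra.
- rewrite Rpower_mult, Rinv_l, Rpower_1; [right; reflexivity| |lra].
  apply cond_pos.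
Qed.

Lemma Rpower_exp_lim_oo (x : R) : 0 <= x ->
  filterlim (fun t => Rpower t x * exp (- t)) (Rbar_locally p_infty) (locally 0).
Proof.
intros hx; apply filterlim_locally; intros eps.
(* One power more than needed: t t^x e^(-t) <= K gives decay like K / t. *)
destruct (Rpower_exp_bounded (x + 1)) as [K [hK0 hK]]; [lra|].
exists (Rmax 1 (K / eps)); intros t ht.
assert (h1 : 1 < t) by (eapply Rle_lt_trans; [apply Rmax_l|exact ht]).
assert (h2 : K / eps < t) by (eapply Rle_lt_trans; [apply Rmax_r|exact ht]).
unfold ball in *; simpl in *; unfold AbsRing_ball, abs, minus, plus, opp in *.
simpl in *; rewrite Ropp_0, Rplus_0_r in *.
rewrite Rabs_pos_eq by (left; apply Rmult_lt_0_compat; apply exp_pos).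
assert (h := hK t ltac:(lra)).
rewrite Rpower_plus, Rpower_1 in h by lra.
apply Rlt_div_l in h2; [|apply cond_pos].
apply Rmult_lt_reg_l with t; lra.
Qed.

(** Integration by parts: the difference of the two integrands is the derivative of t^x e^(-t),
    which vanishes at both ends. *)
Lemma Gamma_succ (x : R) : 0 < x -> Gamma (x + 1) = x * Gamma x.
Proof.
intros hx.
destruct (Gamma_correct x hx) as [h1 _].
destruct (Gamma_correct (x + 1) ltac:(lra)) as [h2 _].
assert (h3 := is_RInt_0_oo_lin _ _ x (-1) _ _ h1 h2).
assert (h4 : is_RInt_0_oo (fun t => x * gamma_integrand x t
               + -1 * gamma_integrand (x + 1) t) (0 - 0)).
{ apply (is_RInt_0_oo_derive (fun t => Rpower t x * exp (- t))).
  - intros t ht; unfold gamma_integrand.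
    replace (x + 1 - 1) with x by ring.
    replace (x * (Rpower t (x - 1) * exp (- t)) + -1 * (Rpower t x * exp (- t)))
      with ((x * Rpower t (x - 1)) * exp (- t) + Rpower t x * (-1 * exp (- t)))
      by ring.
    apply (is_derive_mult (K := R_AbsRing) (fun t => Rpower t x) (fun t => exp (- t))).
    + apply is_derive_Rpower, ht.
    + auto_derive; [auto|ring].
    + intros; apply Rmult_comm.
  - intros t ht; apply (continuous_plus (V := R_NormedModule));
      apply (continuous_scal_r (K := R_AbsRing) (V := R_NormedModule));
      apply continuous_gamma_integrand, ht.
  - apply Rpower_exp_lim_0, hx.
  - apply Rpower_exp_lim_oo; lra. }
assert (e := is_RInt_gen_unique (V := R_CompleteNormedModule) _ _ h3).
rewrite (is_RInt_gen_unique (V := R_CompleteNormedModule) _ _ h4) in e.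
lra.
Qed.

Lemma Gamma_1 : Gamma 1 = 1.
Proof.
destruct (Gamma_correct 1 ltac:(lra)) as [h1 _].
assert (h4 : is_RInt_0_oo (gamma_integrand 1) (0 - -1)).
{ apply (is_RInt_0_oo_derive (fun t => - exp (- t))).
  - intros t ht; unfold gamma_integrand.
    replace (1 - 1) with 0 by ring; rewrite Rpower_O by lra.
    auto_derive; [auto|ring].
  - intros; apply continuous_gamma_integrand; auto.
  - refine (filterlim_filter_le_1 (F := locally 0) _ _ _).
    { intros P [d hd]; exists d; auto. }
    replace (-1) with (- exp (- 0)) by (rewrite Ropp_0, exp_0; ring).
    apply (continuous_opp (V := R_NormedModule) (fun t => exp (- t))).
    apply continuous_exp_opp.
  - apply filterlim_ext_loc with (fun t => -1 * (Rpower t 0 * exp (- t))).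
    { exists 0; intros t ht; rewrite (Rpower_O _ ht); simpl; ring. }
    assert (h0 := filterlim_comp _ _ _ _ _ _ _ _ (Rpower_exp_lim_oo 0 (Rle_refl 0))
      (filterlim_scal_r (K := R_AbsRing) (V := R_NormedModule) (-1) 0)).
    rewrite (scal_zero_r (V := R_NormedModule)) in h0; exact h0. }
assert (e := is_RInt_gen_unique (V := R_CompleteNormedModule) _ _ h1).
rewrite (is_RInt_gen_unique (V := R_CompleteNormedModule) _ _ h4) in e.
lra.
Qed.

(** * Tangent-line bounds for Gamma *)

(** With a = ln r, the tangent of exp at p a is compared with exp at a and at 0. Weighting the two
    inequalities by p and 1 - p cancels the linear terms and leaves e^(p a) <= p e^a + (1 - p). *)
Lemma Rpower_le_tangent (p r : R) : 0 <= p <= 1 -> 0 < r ->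
  Rpower r p <= 1 + p * (r - 1).
Proof.
intros hp hr; unfold Rpower; set (a := ln r).
replace r with (exp a) by (apply exp_ln, hr).
assert (h1 := exp_ineq1_le (a - p * a)).
assert (h2 := exp_ineq1_le (- (p * a))).
assert (hc := exp_pos (p * a)).
assert (e1 : exp a = exp (p * a) * exp (a - p * a))
  by (rewrite <- exp_plus; f_equal; ring).
assert (e2 : 1 = exp (p * a) * exp (- (p * a)))
  by (rewrite <- exp_plus, <- exp_0; f_equal; ring).
apply Rmult_le_compat_l with (r := exp (p * a)) in h1; [|lra].
apply Rmult_le_compat_l with (r := exp (p * a)) in h2; [|lra].
rewrite <- e1 in h1; rewrite <- e2 in h2.
apply Rmult_le_compat_l with (r := p) in h1; [|lra].
apply Rmult_le_compat_l with (r := 1 - p) in h2; [|lra].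
lra.
Qed.

Lemma Rpower_ge_tangent (q r : R) : 0 <= q -> 0 < r ->
  1 - q * (r - 1) <= Rpower r (- q).
Proof.
intros hq hr; unfold Rpower.
assert (h1 := exp_ineq1_le (- q * ln r)).
assert (h2 := ln_le_tangent 1 r ltac:(lra) hr).
rewrite ln_1 in h2; nra.
Qed.

(* Integrates the tangent line at t = y of the concave function t^p. *)
Lemma Gamma_add_le (y p : R) : 0 < y -> 0 <= p <= 1 ->
  Gamma (y + p) <= Rpower y p * Gamma y.
Proof.
intros hy hp.
destruct (Gamma_correct y hy) as [h1 _].
destruct (Gamma_correct (y + 1) ltac:(lra)) as [h2 _].
destruct (Gamma_correct (y + p) ltac:(lra)) as [h3 _].
replace (Rpower y p * Gamma y) with
  (Rpower y p * (1 - p) * Gamma y + Rpower y p * (p / y) * Gamma (y + 1))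
  by (rewrite Gamma_succ by lra; field; lra).
refine (is_RInt_0_oo_le _ _ _ _ _ h3 (is_RInt_0_oo_lin _ _ _ _ _ _ h1 h2)).
intros t ht; split; [left; apply gamma_integrand_pos|].
assert (h := Rpower_le_tangent p (t / y) hp ltac:(apply Rdiv_lt_0_compat; lra)).
assert (h0 := gamma_integrand_pos y t).
replace (gamma_integrand (y + p) t) with
  (gamma_integrand y t * Rpower y p * Rpower (t / y) p).
2:{ unfold gamma_integrand; replace (y + p - 1) with (y - 1 + p) by ring.
    rewrite Rpower_plus.
    replace (Rpower t p) with (Rpower y p * Rpower (t / y) p); [ring|].
    rewrite Rpower_mult_distr by (try apply Rdiv_lt_0_compat; lra).
    f_equal; field; lra. }
replace (gamma_integrand (y + 1) t) with (gamma_integrand y t * t).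
2:{ unfold gamma_integrand; replace (y + 1 - 1) with (y - 1 + 1) by ring.
    rewrite Rpower_plus, Rpower_1 by lra; ring. }
assert (h4 := exp_pos (p * ln y)); fold (Rpower y p) in h4.
replace (Rpower y p * (1 - p) * gamma_integrand y t +
         Rpower y p * (p / y) * (gamma_integrand y t * t))
  with (gamma_integrand y t * Rpower y p * (1 + p * (t / y - 1)))
  by (field; lra).
apply Rmult_le_compat_l; [nra|exact h].
Qed.

(* Integrates the tangent line at t = y + 1 of the convex function t^(-q). *)
Lemma Gamma_add_ge (y q : R) : 0 < y -> 0 <= q <= 1 ->
  Rpower (y + 1) (- q) * Gamma (y + 1) <= Gamma (y + 1 - q).
Proof.
intros hy hq; set (m := y + 1); assert (hm : 1 < m) by (unfold m; lra).
destruct (Gamma_correct m ltac:(lra)) as [h1 _].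
destruct (Gamma_correct (m + 1) ltac:(lra)) as [h2 _].
destruct (Gamma_correct (m - q) ltac:(unfold m; lra)) as [h3 _].
set (c := Rpower m (- q)).
assert (hc : 0 < c) by apply exp_pos.
(* The tangent line can be negative for large t, so its decreasing part is moved to the right to
   keep the smaller integrand nonnegative. The summand [0 * Gamma m] only supplies the two-term
   shape of [is_RInt_0_oo_lin]. *)
cut (c * (1 + q) * Gamma m + 0 * Gamma m <= 1 * Gamma (m - q) + c * (q / m) * Gamma (m + 1)).
{ rewrite (Gamma_succ m) by lra.
  replace (c * (q / m) * (m * Gamma m)) with (c * q * Gamma m) by (field; lra).
  lra. }
refine (is_RInt_0_oo_le _ _ _ _ _ (is_RInt_0_oo_lin _ _ _ _ _ _ h1 h1)
  (is_RInt_0_oo_lin _ _ _ _ _ _ h3 h2)).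
intros t ht.
assert (h0 := gamma_integrand_pos m t).
assert (hcg := Rmult_lt_0_compat _ _ h0 hc).
split; [nra|].
assert (h := Rpower_ge_tangent q (t / m) ltac:(lra) ltac:(apply Rdiv_lt_0_compat; lra)).
replace (gamma_integrand (m - q) t) with
  (gamma_integrand m t * c * Rpower (t / m) (- q)).
2:{ unfold gamma_integrand, c; replace (m - q - 1) with (m - 1 + - q) by ring.
    rewrite Rpower_plus.
    replace (Rpower t (- q)) with (Rpower m (- q) * Rpower (t / m) (- q)); [ring|].
    rewrite Rpower_mult_distr by (try apply Rdiv_lt_0_compat; lra).
    f_equal; field; lra. }
replace (gamma_integrand (m + 1) t) with (gamma_integrand m t * t).
2:{ unfold gamma_integrand; replace (m + 1 - 1) with (m - 1 + 1) by ring.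
    rewrite Rpower_plus, Rpower_1 by lra; ring. }
apply Rmult_le_compat_l with (r := gamma_integrand m t * c) in h; [|nra].
replace (c * (q / m) * (gamma_integrand m t * t))
  with (gamma_integrand m t * c * (q * (t / m))) by (field; lra).
lra.
Qed.

(** * Series for ln Gamma *)

Lemma is_lim_seq_inv_INR_succ : is_lim_seq (fun n => / INR (S n)) 0.
Proof.
apply (is_lim_seq_incr_1 (fun n => / INR n)).
apply (is_lim_seq_inv INR p_infty); [apply is_lim_seq_INR|discriminate].
Qed.

Lemma is_lim_seq_ln_shift (x : R) : -1 < x ->
  is_lim_seq (fun n => ln (INR (S n) + x) - ln (INR (S n))) 0.
Proof.
intros hx.
apply is_lim_seq_ext with (fun n => ln (1 + x * / INR (S n))).
{ intros n; assert (h := pos_INR n); rewrite S_INR.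
  rewrite <- ln_div by lra; f_equal; field; lra. }
rewrite <- ln_1.
apply (is_lim_seq_continuous ln).
{ apply derivable_continuous_pt; exists (/ 1); apply derivable_pt_lim_ln; lra. }
replace (Finite 1) with (Finite (1 + x * 0)) by (f_equal; ring).
apply is_lim_seq_plus'; [apply is_lim_seq_const|].
apply is_lim_seq_mult'; [apply is_lim_seq_const|apply is_lim_seq_inv_INR_succ].
Qed.

Lemma ln_le (x y : R) : 0 < x -> x <= y -> ln x <= ln y.
Proof.
intros hx [h| ->]; [left; apply ln_increasing; auto|right; reflexivity].
Qed.

(** The lower bound is [Gamma_add_ge] with q = 1 - x, which yields (1 - x) (ln y - ln (y + 1)) and
    is weakened to a form free of x. Both bounds tend to 0 as y grows, ready for a squeeze. *)
Lemma ln_Gamma_add_bounds (y x : R) : 0 < y -> 0 <= x <= 1 ->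
  ln y - ln (y + 1) <= ln (Gamma (y + x)) - ln (Gamma y) - x * ln y <= 0.
Proof.
intros hy hx.
assert (h0 := Gamma_pos y hy).
assert (h1 := Gamma_pos (y + x) ltac:(lra)).
split.
- assert (h := Gamma_add_ge y (1 - x) hy ltac:(lra)).
  replace (y + 1 - (1 - x)) with (y + x) in h by ring.
  rewrite Gamma_succ in h by lra.
  apply ln_le in h.
  2:{ apply Rmult_lt_0_compat; [apply exp_pos|nra]. }
  rewrite ln_mult, ln_mult in h by (try apply exp_pos; nra).
  unfold Rpower in h; rewrite ln_exp in h.
  assert (ln y <= ln (y + 1)) by (apply ln_le; lra).
  nra.
- assert (h := Gamma_add_le y x hy hx).
  apply ln_le in h; [|lra].
  rewrite ln_mult in h by (try apply exp_pos; lra).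
  unfold Rpower in h; rewrite ln_exp in h; lra.
Qed.

Lemma ln_Gamma_succ (y : R) : 0 < y -> ln (Gamma (y + 1)) = ln y + ln (Gamma y).
Proof.
intros hy; rewrite Gamma_succ by lra; apply ln_mult; [lra|apply Gamma_pos, hy].
Qed.

(** The squeeze covers [0, 1]. The functional equation moves z by 1 at the cost of ln (N + z) - ln N
    or ln (N + z - 1) - ln N, which tends to 0: one step down reaches (-1, 0], and induction climbs
    to larger z. *)
Lemma ln_Gamma_asymptotic (x : R) : -1 < x ->
  is_lim_seq (fun n => ln (Gamma (INR (S n) + x)) - ln (Gamma (INR (S n)))
                       - x * ln (INR (S n))) 0.
Proof.
intros hx.
assert (h01 : forall z, 0 <= z <= 1 ->
  is_lim_seq (fun n => ln (Gamma (INR (S n) + z)) - ln (Gamma (INR (S n)))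
                       - z * ln (INR (S n))) 0).
{ intros z hz.
  apply is_lim_seq_le_le with
    (fun n => - (ln (INR (S n) + 1) - ln (INR (S n)))) (fun _ => 0).
  - intros n; assert (h := ln_Gamma_add_bounds (INR (S n)) z).
    assert (h' := lt_0_INR (S n) ltac:(lia)); specialize (h h' hz); lra.
  - replace (Finite 0) with (Finite (- 0)) by (f_equal; ring).
    apply (is_lim_seq_opp _ 0), is_lim_seq_ln_shift; lra.
  - apply is_lim_seq_const. }
assert (hm : forall (m : nat) z, -1 < z <= INR m ->
  is_lim_seq (fun n => ln (Gamma (INR (S n) + z)) - ln (Gamma (INR (S n)))
                       - z * ln (INR (S n))) 0).
{ induction m as [|m IH]; intros z hz.
  - simpl in hz.
    apply is_lim_seq_ext with (fun n =>
      ln (Gamma (INR (S n) + (z + 1))) - ln (Gamma (INR (S n)))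
                       - (z + 1) * ln (INR (S n))
      - (ln (INR (S n) + z) - ln (INR (S n)))).
    + intros n; assert (h := pos_INR n); rewrite S_INR.
      replace (INR n + 1 + (z + 1)) with (INR n + 1 + z + 1) by ring.
      rewrite (ln_Gamma_succ (INR n + 1 + z)) by lra; ring.
    + replace (Finite 0) with (Finite (0 - 0)) by (f_equal; ring).
      apply is_lim_seq_minus'; [apply h01; lra|apply is_lim_seq_ln_shift; lra].
  - destruct (Rle_lt_dec z 0) as [h0|h0].
    { apply IH; assert (h := pos_INR m); lra. }
    rewrite S_INR in hz.
    apply is_lim_seq_ext with (fun n =>
      ln (Gamma (INR (S n) + (z - 1))) - ln (Gamma (INR (S n)))
                       - (z - 1) * ln (INR (S n))
      + (ln (INR (S n) + (z - 1)) - ln (INR (S n)))).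
    + intros n; assert (h := pos_INR n); rewrite S_INR.
      replace (INR n + 1 + z) with (INR n + 1 + (z - 1) + 1) by ring.
      rewrite (ln_Gamma_succ (INR n + 1 + (z - 1))) by lra; ring.
    + replace (Finite 0) with (Finite (0 + 0)) by (f_equal; ring).
      apply is_lim_seq_plus'; [apply IH; lra|apply is_lim_seq_ln_shift; lra]. }
destruct (nfloor_ex (x + 1)) as [m hm']; [lra|].
apply (hm m); lra.
Qed.

(** [real] and [Lim_seq] are total, so [euler_gamma] means something only once convergence is known:
    the sequence decreases and is bounded below by 0. *)
Lemma euler_gamma_correct :
  is_lim_seq (fun n => sum_f_R0 (fun k => / INR (S k)) n - ln (INR (S n)))
    euler_gamma.
Proof.
unfold euler_gamma; apply Lim_seq_correct'.
apply ex_finite_lim_seq_decr with 0.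
- intros n; rewrite tech5.
  assert (h0 := pos_INR n).
  assert (h := ln_le_tangent (INR (S (S n))) (INR (S n))).
  rewrite !S_INR in *.
  specialize (h ltac:(lra) ltac:(lra)).
  replace ((INR n + 1) / (INR n + 1 + 1)) with (1 - / (INR n + 1 + 1)) in h
    by (field; lra).
  lra.
- intros n.
  (* Strengthened so that the induction closes: the new term 1 / (n + 2) dominates ln (n + 3) - ln
     (n + 2), but not ln (n + 2) - ln (n + 1). *)
  cut (ln (INR (S (S n))) <= sum_f_R0 (fun k : nat => / INR (S k)) n).
  { intros h; assert (ln (INR (S n)) <= ln (INR (S (S n)))); [|lra].
    apply ln_le; [apply lt_0_INR; lia|apply le_INR; lia]. }
  induction n as [|n IH].
  + assert (h := ln_le_tangent 1 2 ltac:(lra) ltac:(lra)).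
    rewrite ln_1 in h; simpl; replace (1 + 1) with 2 by ring; lra.
  + rewrite tech5.
    assert (h0 := pos_INR n).
    assert (h := ln_le_tangent (INR (S (S n))) (INR (S (S (S n))))).
    rewrite !S_INR in *.
    specialize (h ltac:(lra) ltac:(lra)).
    replace ((INR n + 1 + 1 + 1) / (INR n + 1 + 1)) with (1 + / (INR n + 1 + 1)) in h
      by (field; lra).
    lra.
Qed.

(** The logarithm of Weierstrass's product for Gamma(x + 1). *)
Lemma ln_Gamma_series (x : R) : -1 < x ->
  is_series (fun j => x * / INR (S j) - (ln (INR (S j) + x) - ln (INR (S j))))
    (ln (Gamma (x + 1)) + x * euler_gamma).
Proof.
intros hx.
change (is_lim_seq (sum_n (fun j => x * / INR (S j)
  - (ln (INR (S j) + x) - ln (INR (S j))))) (ln (Gamma (x + 1)) + x * euler_gamma)).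
(* An exact formula for the partial sum with N = n + 1 terms, by the functional equation. The
   asymptotic enters at N + 1, while [euler_gamma] uses ln N; the last summand corrects this
   mismatch. *)
apply is_lim_seq_ext with (fun n =>
  ln (Gamma (x + 1))
  + x * (sum_f_R0 (fun k => / INR (S k)) n - ln (INR (S n)))
  - (ln (Gamma (INR (S (S n)) + x)) - ln (Gamma (INR (S (S n))))
                       - x * ln (INR (S (S n))))
  - x * (ln (INR (S n) + 1) - ln (INR (S n)))).
- induction n as [|n IH].
  + rewrite sum_O; simpl.
    replace (1 + 1 + x) with (x + 1 + 1) by ring.
    rewrite (ln_Gamma_succ (x + 1)), (ln_Gamma_succ 1), Gamma_1 by lra.
    replace (1 + x) with (x + 1) by ring.
    rewrite ln_1; field.
  + rewrite sum_Sn, <- IH; rewrite tech5.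
    assert (h0 := pos_INR n).
    rewrite !S_INR.
    replace (INR n + 1 + 1 + 1 + x) with (INR n + 1 + 1 + x + 1) by ring.
    rewrite (ln_Gamma_succ (INR n + 1 + 1 + x)), (ln_Gamma_succ (INR n + 1 + 1)) by lra.
    unfold Hierarchy.plus; simpl; ring.
- replace (Finite (ln (Gamma (x + 1)) + x * euler_gamma)) with
    (Finite (ln (Gamma (x + 1)) + x * euler_gamma - 0 - x * 0)) by (f_equal; ring).
  apply is_lim_seq_minus'; [apply is_lim_seq_minus'; [apply is_lim_seq_plus'|]|].
  + apply is_lim_seq_const.
  + apply is_lim_seq_mult'; [apply is_lim_seq_const|apply euler_gamma_correct].
  + apply (is_lim_seq_incr_1 (fun n => ln (Gamma (INR (S n) + x))
      - ln (Gamma (INR (S n))) - x * ln (INR (S n)))), ln_Gamma_asymptotic, hx.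
  + apply is_lim_seq_mult'; [apply is_lim_seq_const|apply is_lim_seq_ln_shift; lra].
Qed.

(** * Termwise differentiation *)

Definition kernel (n : nat) (c x u : R) : R := u ^ n / (c + x * u) ^ S n.

Definition kernel_integral (n : nat) (c x : R) : R := RInt (kernel n c x) 0 1.

Lemma kernel_denom_pos (c x u : R) : 1 <= c -> -1 < x -> 0 <= u <= 1 -> 0 < c + x * u.
Proof. intros hc hx [[hu| <-] hu']; [nra|lra]. Qed.

Lemma continuous_kernel (n : nat) (c x u : R) : 0 < c + x * u ->
  continuous (kernel n c x) u.
Proof.
intros h; apply (ex_derive_continuous (V := R_NormedModule)).
unfold kernel; auto_derive; apply (pow_nonzero _ (S n)); lra.
Qed.

Lemma ex_RInt_01 (f : R -> R) :
  (forall u, 0 <= u <= 1 -> continuous f u) -> ex_RInt f 0 1.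
Proof.
intros h; apply (ex_RInt_continuous (V := R_CompleteNormedModule)).
intros u hu; rewrite Rmin_left, Rmax_right in hu by lra; auto.
Qed.

Lemma ex_RInt_kernel (n : nat) (c x : R) : 1 <= c -> -1 < x ->
  ex_RInt (kernel n c x) 0 1.
Proof.
intros hc hx; apply ex_RInt_01; intros u hu.
apply continuous_kernel, kernel_denom_pos; auto.
Qed.

Lemma is_derive_kernel (n : nat) (c x u : R) : 0 < c + x * u ->
  is_derive (fun y => kernel n c y u) x (- INR (S n) * kernel (S n) c x u).
Proof.
intros h; unfold kernel; evar_last.
- auto_derive; [apply (pow_nonzero _ (S n)); lra|reflexivity].
- simpl Nat.pred; simpl pow.
  change (match n with 0%nat => 1 | S _ => INR n + 1 end) with (INR (S n)).
  field; split; try lra; apply pow_nonzero; lra.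
Qed.

Lemma continuity_2d_kernel (n : nat) (c x u : R) : 0 < c + x * u ->
  continuity_2d_pt (fun y v => kernel n c y v) x u.
Proof.
intros h; unfold kernel, Rdiv.
apply (continuity_2d_pt_mult (fun y v => v ^ n)
  (fun y v => / (c + y * v) ^ S n)).
- apply (continuity_1d_2d_pt_comp (fun v => v ^ n)); [|apply continuity_2d_pt_id2].
  apply derivable_continuous_pt, derivable_pt_pow.
- apply (continuity_2d_pt_inv (fun y v => (c + y * v) ^ S n)).
  + apply (continuity_1d_2d_pt_comp (fun v => v ^ S n) (fun y v => c + y * v)).
    * apply derivable_continuous_pt, derivable_pt_pow.
    * apply (continuity_2d_pt_plus (fun _ _ => c) (fun y v => y * v));
        [apply continuity_2d_pt_const|].
      apply (continuity_2d_pt_mult (fun y _ => y) (fun _ v => v));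
        [apply continuity_2d_pt_id1|apply continuity_2d_pt_id2].
  + apply pow_nonzero; lra.
Qed.

Lemma locally_gt (a x : R) : a < x -> locally x (fun y => a < y).
Proof. intros h; apply (open_gt a x h). Qed.

Lemma is_derive_kernel_integral (n : nat) (c x : R) : 1 <= c -> -1 < x ->
  is_derive (kernel_integral n c) x (- INR (S n) * kernel_integral (S n) c x).
Proof.
intros hc hx; unfold kernel_integral.
replace (- INR (S n) * RInt (kernel (S n) c x) 0 1) with
  (RInt (fun u => Derive (fun y => kernel n c y u) x) 0 1).
- apply (is_derive_RInt_param (fun y u => kernel n c y u)).
  + apply (filter_imp (fun y => -1 < y)); [|apply locally_gt, hx].
    intros y hy u hu; rewrite Rmin_left, Rmax_right in hu by lra.
    eexists; apply is_derive_kernel, kernel_denom_pos; auto.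
  + intros u hu; rewrite Rmin_left, Rmax_right in hu by lra.
    assert (h := kernel_denom_pos c x u hc hx hu).
    apply continuity_2d_pt_ext_loc with
      (fun y v => - INR (S n) * kernel (S n) c y v).
    (* The tolerance is c + x u itself, so that denominators near (x, u) stay positive and the
       derivative formula holds there. *)
    * destruct (continuity_2d_pt_plus (fun _ _ => c) (fun y v => y * v) x u)
        with (eps := mkposreal _ h) as [d hd].
      { apply continuity_2d_pt_const. }
      { apply (continuity_2d_pt_mult (fun y _ => y) (fun _ v => v));
        [apply continuity_2d_pt_id1|apply continuity_2d_pt_id2]. }
      exists d; intros y v hy hv; symmetry; apply is_derive_unique.
      apply is_derive_kernel.
      specialize (hd y v hy hv); simpl in hd; apply Rabs_def2 in hd; lra.
    * apply (continuity_2d_pt_mult (fun _ _ => - INR (S n))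
        (fun y v => kernel (S n) c y v)).
      { apply continuity_2d_pt_const. }
      apply continuity_2d_kernel, h.
  + apply (filter_imp (fun y => -1 < y)); [|apply locally_gt, hx].
    intros y hy; apply ex_RInt_kernel; auto.
- rewrite <- (RInt_scal (V := R_CompleteNormedModule) _ 0 1 (- INR (S n))).
  2: apply ex_RInt_kernel; auto.
  apply RInt_ext; intros u hu; rewrite Rmin_left, Rmax_right in hu by lra.
  apply is_derive_unique, is_derive_kernel, kernel_denom_pos; auto; lra.
Qed.

(** Staying at distance d from -1 makes the bound uniform in x, as termwise differentiation
    requires: c + x u >= c - (1 - d) >= d c because c >= 1. *)
Lemma kernel_integral_bounds (n : nat) (c x d : R) : 1 <= c -> 0 < d <= 1 -> d - 1 <= x ->
  0 <= kernel_integral n c x <= / (d * c) ^ S n.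
Proof.
intros hc hd hx.
assert (hk : forall u, 0 <= u <= 1 -> 0 <= kernel n c x u <= / (d * c) ^ S n).
{ intros u hu; unfold kernel.
  assert (h1 : d * c <= c + x * u) by nra.
  assert (h0 : 0 < d * c) by nra.
  assert (h2 := pow_lt _ (S n) h0).
  assert (h3 := pow_incr _ _ (S n) (conj (Rlt_le _ _ h0) h1)).
  assert (h4 := pow_le u n (proj1 hu)).
  assert (h5 : u ^ n <= 1) by (rewrite <- (pow1 n); apply pow_incr; lra).
  assert (h6 := Rinv_le_contravar _ _ h2 h3).
  assert (h7 := Rinv_0_lt_compat ((c + x * u) ^ S n) ltac:(lra)).
  unfold Rdiv; split; nra. }
assert (hx' : -1 < x) by lra.
split.
- apply RInt_ge_0; [lra|apply ex_RInt_kernel; auto|].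
  intros u hu; apply hk; lra.
- replace (/ (d * c) ^ S n) with (RInt (fun _ => / (d * c) ^ S n) 0 1).
  2:{ rewrite RInt_const; unfold scal; simpl; unfold mult; simpl; ring. }
  apply RInt_le; [lra|apply ex_RInt_kernel; auto|apply ex_RInt_const|].
  intros u hu; apply hk; lra.
Qed.

(** Absorbs the exponent 1 / x of [Gamma_root]: [kernel_integral 0 c] extends (ln (c + x) - ln c) /
    x smoothly across x = 0. *)
Lemma kernel_integral_0 (c x : R) : 1 <= c -> -1 < x ->
  x * kernel_integral 0 c x = ln (c + x) - ln c.
Proof.
intros hc hx; unfold kernel_integral.
assert (h : is_RInt (fun u => x * kernel 0 c x u) 0 1 (ln (c + x) - ln c)).
{ replace (ln (c + x) - ln c) with (ln (c + x * 1) - ln (c + x * 0))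
    by (do 2 f_equal; ring).
  apply (is_RInt_derive (V := R_CompleteNormedModule) (fun u => ln (c + x * u)));
    intros u hu; rewrite Rmin_left, Rmax_right in hu by lra;
    assert (h := kernel_denom_pos c x u hc hx hu).
  - unfold kernel; auto_derive; [exact h|field; lra].
  - apply (continuous_scal_r (K := R_AbsRing) (V := R_NormedModule)).
    apply continuous_kernel, h. }
apply (is_RInt_unique (V := R_CompleteNormedModule)) in h; rewrite <- h; symmetry.
apply (RInt_scal (V := R_CompleteNormedModule)), ex_RInt_kernel; auto.
Qed.

Lemma kernel_integral_0_0 (c : R) : 1 <= c -> kernel_integral 0 c 0 = / c.
Proof.
intros hc; unfold kernel_integral.
rewrite (RInt_ext _ (fun _ => / c)).
- rewrite RInt_const; unfold scal; simpl; unfold mult; simpl; ring.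
- intros u _; unfold kernel; simpl; field; lra.
Qed.

Lemma is_series_telescope :
  is_series (fun j => / (INR (S j) * INR (S (S j)))) 1.
Proof.
change (is_lim_seq (sum_n (fun j => / (INR (S j) * INR (S (S j))))) 1).
apply is_lim_seq_ext with (fun n => 1 - / INR (S (S n))).
- induction n as [|n IH].
  + rewrite sum_O; simpl; field.
  + rewrite sum_Sn, <- IH.
    assert (h := pos_INR n); rewrite !S_INR; unfold Hierarchy.plus; simpl; field; lra.
- replace (Finite 1) with (Finite (1 - 0)) by (f_equal; ring).
  apply is_lim_seq_minus'; [apply is_lim_seq_const|].
  apply (is_lim_seq_incr_1 (fun n => / INR (S n))), is_lim_seq_inv_INR_succ.
Qed.

(** A telescoping series stands in for the sum of 1 / c^2; the factor 2 pays for 1 / c^2 <= 2 / (c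
    (c + 1)) when c >= 1. *)
Definition series_majorant (n : nat) (d : R) (j : nat) : R :=
  2 / d ^ S n * / (INR (S j) * INR (S (S j))).

Lemma ex_series_majorant (n : nat) (d : R) : ex_series (series_majorant n d).
Proof.
apply (ex_series_scal_l (K := R_AbsRing) (V := R_NormedModule) (2 / d ^ S n)).
eexists; apply is_series_telescope.
Qed.

Lemma kernel_integral_le_majorant (n j : nat) (x d : R) : 0 < d <= 1 -> d - 1 <= x ->
  0 <= kernel_integral (S n) (INR (S j)) x <= series_majorant (S n) d j.
Proof.
intros hd hx.
assert (hj := pos_INR j).
assert (hc : 1 <= INR (S j)) by (rewrite S_INR; lra).
destruct (kernel_integral_bounds (S n) (INR (S j)) x d hc hd hx) as [h1 h2].
split; [exact h1|]; apply Rle_trans with (1 := h2).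
unfold series_majorant; rewrite (S_INR (S j)); set (c := INR (S j)) in *.
rewrite Rpow_mult_distr, Rinv_mult.
assert (hdn : 0 < / d ^ S (S n)) by (apply Rinv_0_lt_compat, pow_lt; lra).
replace (2 / d ^ S (S n) * / (c * (c + 1))) with
  (/ d ^ S (S n) * (2 / (c * (c + 1)))) by (unfold Rdiv; ring).
apply Rmult_le_compat_l; [lra|].
assert (h5 : 1 <= c ^ n) by (apply pow_R1_Rle, hc).
apply Rle_trans with (/ (c * c)).
- apply Rinv_le_contravar; [nra|].
  replace (c ^ S (S n)) with (c * c * c ^ n) by (simpl; ring); nra.
- apply Rle_div_r; [nra|].
  replace (/ (c * c) * (c * (c + 1))) with (1 + / c) by (field; lra).
  assert (/ c <= / 1) by (apply Rinv_le_contravar; lra).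
  lra.
Qed.

(** * Differentiating a series of functions *)

Lemma is_series_Rabs_le (a b : nat -> R) (la lb : R) :
  (forall n, Rabs (a n) <= b n) -> is_series a la -> is_series b lb ->
  Rabs la <= lb.
Proof.
intros h ha hb.
assert (he : ex_series (fun n => Rabs (a n))).
{ apply (ex_series_le (K := R_AbsRing) (V := R_CompleteNormedModule) _ b);
    [|eexists; exact hb].
  intros n; unfold norm; simpl; unfold abs; simpl; rewrite Rabs_Rabsolu; auto. }
rewrite <- (is_series_unique _ _ ha), <- (is_series_unique _ _ hb).
apply Rle_trans with (1 := Series_Rabs _ he).
apply Series_le; [|eexists; exact hb].
intros n; split; [apply Rabs_pos|auto].
Qed.

(** Two uses of the mean value theorem, for f and then for f'. They lose Taylor's factor 1/2, which
    is harmless for differentiability. *)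
Lemma taylor_1_bound (f f' f'' : R -> R) (a M x y : R) :
  (forall z, a < z -> is_derive f z (f' z)) ->
  (forall z, a < z -> is_derive f' z (f'' z)) ->
  (forall z, a < z -> Rabs (f'' z) <= M) ->
  a < x -> a < y ->
  Rabs (f y - f x - f' x * (y - x)) <= M * (y - x) ^ 2.
Proof.
intros h1 h2 hM hx hy.
assert (hmin : forall u v, a < u -> a < v -> a < Rmin u v)
  by (intros; apply Rmin_glb_lt; auto).
assert (hcont : forall g g' : R -> R, (forall z, a < z -> is_derive g z (g' z)) ->
  forall z, a < z -> continuity_pt g z).
{ intros g g' hg z hz; apply derivable_continuous_pt; exists (g' z).
  apply is_derive_Reals, hg, hz. }
destruct (MVT_gen f x y f') as [c [hc e]].
{ intros z hz; apply h1; specialize (hmin x y hx hy); lra. }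
{ intros z hz; apply (hcont f f'); auto; specialize (hmin x y hx hy); lra. }
assert (hac : a < c) by (specialize (hmin x y hx hy); lra).
destruct (MVT_gen f' x c f'') as [c' [hc' e']].
{ intros z hz; apply h2; specialize (hmin x c hx hac); lra. }
{ intros z hz; apply (hcont f' f''); auto; specialize (hmin x c hx hac); lra. }
assert (hac' : a < c') by (specialize (hmin x c hx hac); lra).
rewrite e.
replace (f' c * (y - x) - f' x * (y - x)) with (f'' c' * ((c - x) * (y - x)))
  by (rewrite <- Rmult_assoc, <- e'; ring).
rewrite Rabs_mult; apply Rmult_le_compat; try apply Rabs_pos; auto.
rewrite Rabs_mult, <- (pow2_abs (y - x)).
assert (h : Rabs (c - x) <= Rabs (y - x)).
{ unfold Rmin, Rmax in hc; destruct (Rle_dec x y).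
  - rewrite !Rabs_pos_eq; lra.
  - rewrite !Rabs_left1; lra. }
assert (h' := Rabs_pos (y - x)); nra.
Qed.

(** Summable bounds on the second derivatives replace an argument by uniform convergence: the
    first-order Taylor remainders add up to at most S (y - x)^2. *)
Lemma is_derive_series (f f' f'' : nat -> R -> R) (M : nat -> R) (F G : R -> R)
    (a x : R) :
  (forall j z, a < z -> is_derive (f j) z (f' j z)) ->
  (forall j z, a < z -> is_derive (f' j) z (f'' j z)) ->
  (forall j z, a < z -> Rabs (f'' j z) <= M j) ->
  ex_series M ->
  (forall z, a < z -> is_series (fun j => f j z) (F z)) ->
  (forall z, a < z -> is_series (fun j => f' j z) (G z)) ->
  a < x -> is_derive F x (G x).
Proof.
intros h1 h2 hM [S hS] hF hG hx.
assert (hS0 : 0 <= S).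
{ apply Rle_trans with (Rabs S); [apply Rabs_pos|].
  apply (is_series_Rabs_le M M); auto.
  intros n; rewrite Rabs_pos_eq; [lra|].
  apply Rle_trans with (2 := hM n x hx), Rabs_pos. }
assert (hb : forall y, a < y -> Rabs (F y - F x - G x * (y - x)) <= S * (y - x) ^ 2).
{ intros y hy.
  apply (is_series_Rabs_le (fun j => f j y - f j x - f' j x * (y - x))
    (fun j => M j * (y - x) ^ 2)).
  - intros j; apply (taylor_1_bound _ _ (f'' j) a); auto.
  - apply (is_series_minus (K := R_AbsRing) (V := R_NormedModule)).
    + apply (is_series_minus (K := R_AbsRing) (V := R_NormedModule)); auto.
    + apply (is_series_scal_r (y - x) (fun j => f' j x)); auto.
  - apply (is_series_scal_r ((y - x) ^ 2) M); auto. }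
apply is_derive_Reals; intros eps heps.
(* The first bound keeps x + h above a; [S + 1] avoids a division by zero, as S may vanish. *)
assert (hd : 0 < Rmin (x - a) (eps / (S + 1))).
{ apply Rmin_glb_lt; [lra|apply Rdiv_lt_0_compat; lra]. }
exists (mkposreal _ hd); intros h h0 hh; simpl in hh.
assert (hh1 : Rabs h < x - a) by (eapply Rlt_le_trans; [exact hh|apply Rmin_l]).
assert (hh2 : Rabs h < eps / (S + 1)) by (eapply Rlt_le_trans; [exact hh|apply Rmin_r]).
apply Rabs_def2 in hh1.
specialize (hb (x + h) ltac:(lra)).
replace (x + h - x) with h in hb by ring.
replace ((F (x + h) - F x) / h - G x) with ((F (x + h) - F x - G x * h) / h)
  by (field; auto).
assert (hp := Rabs_pos_lt h h0).
rewrite Rabs_div by auto.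
apply Rlt_div_l; [exact hp|].
apply Rle_lt_trans with (1 := hb); rewrite <- pow2_abs.
apply Rlt_div_r in hh2; [|lra].
nra.
Qed.

(** * Logarithmic complete monotonicity *)

(** Only the logarithm of the ratio has computed derivatives, while smoothness is required of the
    ratio itself. Carrying a derivative on the whole half-line at each stage makes closure under
    products and exp a direct induction. *)
Fixpoint n_smooth_above (a : R) (n : nat) (f : R -> R) : Prop :=
  match n with
  | O => True
  | S m => exists f' : R -> R,
      (forall x, a < x -> is_derive f x (f' x)) /\ n_smooth_above a m f'
  end.

Lemma n_smooth_above_pred (a : R) (n : nat) (f : R -> R) :
  n_smooth_above a (S n) f -> n_smooth_above a n f.
Proof.
revert f; induction n as [|n IH]; intros f; [simpl; auto|].
intros [f' [h1 h2]]; exists f'; auto.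
Qed.

Lemma n_smooth_above_plus (a : R) (n : nat) (f g : R -> R) :
  n_smooth_above a n f -> n_smooth_above a n g ->
  n_smooth_above a n (fun x => f x + g x).
Proof.
revert f g; induction n as [|n IH]; intros f g; [simpl; auto|].
intros [f' [hf hf']] [g' [hg hg']]; exists (fun x => f' x + g' x); split; auto.
intros x hx; apply (is_derive_plus (K := R_AbsRing) (V := R_NormedModule)); auto.
Qed.

Lemma n_smooth_above_mult (a : R) (n : nat) (f g : R -> R) :
  n_smooth_above a n f -> n_smooth_above a n g ->
  n_smooth_above a n (fun x => f x * g x).
Proof.
revert f g; induction n as [|n IH]; intros f g; [simpl; auto|].
intros hf0 hg0; destruct (hf0) as [f' [hf hf']]; destruct (hg0) as [g' [hg hg']].
exists (fun x => f' x * g x + f x * g' x); split.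
- intros x hx; apply (is_derive_mult (K := R_AbsRing)); auto.
  intros; apply Rmult_comm.
- apply n_smooth_above_plus; apply IH; auto; apply n_smooth_above_pred; auto.
Qed.

Lemma n_smooth_above_exp (a : R) (n : nat) (f : R -> R) :
  n_smooth_above a n f -> n_smooth_above a n (fun x => exp (f x)).
Proof.
revert f; induction n as [|n IH]; intros f; [simpl; auto|].
intros hf0; destruct (hf0) as [f' [hf hf']].
exists (fun x => f' x * exp (f x)); split.
- intros x hx.
  apply (is_derive_comp (V := R_NormedModule) exp f); [apply is_derive_exp|auto].
- apply n_smooth_above_mult; auto; apply IH, n_smooth_above_pred; auto.
Qed.

Lemma Derive_n_succ_above (a : R) (n : nat) (f f' : R -> R) :
  (forall x, a < x -> is_derive f x (f' x)) ->
  forall x, a < x -> Derive_n f (S n) x = Derive_n f' n x.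
Proof.
intros hf x hx.
replace (S n) with (n + 1)%nat by lia.
rewrite <- Derive_n_comp; apply Derive_n_ext_loc.
apply (filter_imp (fun y => a < y)); [|apply locally_gt, hx].
intros y hy; apply is_derive_unique; auto.
Qed.

Lemma n_smooth_above_ex_derive_n (a : R) (n : nat) (f : R -> R) :
  n_smooth_above a n f -> forall x, a < x -> ex_derive_n f n x.
Proof.
revert f; induction n as [|n IH]; intros f; [simpl; auto|].
intros [f' [hf hf']] x hx; destruct n as [|n].
- exists (f' x); apply hf, hx.
- apply ex_derive_ext_loc with (Derive_n f' n); [|apply (IH f'); auto].
  apply (filter_imp (fun y => a < y)); [|apply locally_gt, hx].
  intros y hy; symmetry; apply (Derive_n_succ_above a); auto.
Qed.

Lemma derivative_sequence_smooth (a : R) (D : nat -> R -> R) :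
  (forall n x, a < x -> is_derive (D n) x (D (S n) x)) ->
  forall n m, n_smooth_above a n (D m).
Proof.
intros hD n; induction n as [|n IH]; intros m; [exact I|].
exists (D (S m)); auto.
Qed.

Lemma derivative_sequence_Derive_n (a : R) (D : nat -> R -> R) :
  (forall n x, a < x -> is_derive (D n) x (D (S n) x)) ->
  forall n m x, a < x -> Derive_n (D m) n x = D (m + n)%nat x.
Proof.
intros hD n; induction n as [|n IH]; intros m x hx.
- simpl; f_equal; lia.
- rewrite (Derive_n_succ_above a n (D m) (D (S m))); auto.
  rewrite IH by auto; f_equal; lia.
Qed.

(** * Derivatives of the logarithm of Gamma_root and of the ratio *)

Lemma ln_Gamma_root_series (x : R) : -1 < x ->
  is_series (fun j => / INR (S j) - kernel_integral 0 (INR (S j)) x)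
    (ln (Gamma_root x) + euler_gamma).
Proof.
intros hx.
assert (hc : forall j, 1 <= INR (S j)).
{ intros j; assert (h := pos_INR j); rewrite S_INR; lra. }
unfold Gamma_root; destruct (Req_dec_T x 0) as [-> |h0].
(* At x = 0 every term vanishes, in agreement with the assigned value; the zero series is presented
   as 0 times a convergent one. *)
- rewrite ln_exp; replace (- euler_gamma + euler_gamma) with (0 * 1) by ring.
  assert (e : forall j, 0 * / (INR (S j) * INR (S (S j))) =
    / INR (S j) - kernel_integral 0 (INR (S j)) 0).
  { intros j; rewrite kernel_integral_0_0 by auto; ring. }
  apply (is_series_ext _ _ _ e).
  apply (is_series_scal_l (K := R_AbsRing) (V := R_NormedModule) 0).
  apply is_series_telescope.
- unfold Rpower; rewrite ln_exp.
  replace (1 / x * ln (Gamma (x + 1)) + euler_gamma) with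
    (/ x * (ln (Gamma (x + 1)) + x * euler_gamma)) by (field; auto).
  assert (e : forall j, / x * (x * / INR (S j) - (ln (INR (S j) + x) - ln (INR (S j))))
    = / INR (S j) - kernel_integral 0 (INR (S j)) x).
  { intros j; rewrite <- kernel_integral_0 by auto; field; split; auto.
    specialize (hc j); lra. }
  apply (is_series_ext _ _ _ e).
  apply (is_series_scal_l (K := R_AbsRing) (V := R_NormedModule) (/ x)).
  apply ln_Gamma_series, hx.
Qed.

(** Meaningful for n >= 1. For n = 0 the terms behave like 1 / c and the series diverges, so order 0
    keeps the corrected terms 1 / c - K_0(c, x). *)
Definition kernel_series (n : nat) (x : R) : R := Series (fun j => kernel_integral n (INR (S j)) x).

Lemma subinterval_radius_exists (x : R) : -1 < x -> exists d, 0 < d <= 1 /\ d - 1 < x.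
Proof.
intros hx; exists (Rmin 1 ((x + 1) / 2)).
assert (h1 := Rmin_l 1 ((x + 1) / 2)); assert (h2 := Rmin_r 1 ((x + 1) / 2)).
repeat split; [apply Rmin_glb_lt| |]; lra.
Qed.

Lemma kernel_series_correct (n : nat) (x : R) : -1 < x ->
  is_series (fun j => kernel_integral (S n) (INR (S j)) x) (kernel_series (S n) x).
Proof.
intros hx; destruct (subinterval_radius_exists x hx) as [d [hd hdx]].
apply Series_correct.
apply (ex_series_le (K := R_AbsRing) (V := R_CompleteNormedModule) _ (series_majorant (S n) d));
  [|apply ex_series_majorant].
intros j; destruct (kernel_integral_le_majorant n j x d hd ltac:(lra)).
unfold norm; simpl; unfold abs; simpl; rewrite Rabs_pos_eq; auto.
Qed.

Lemma INR_succ_ge_1 (j : nat) : 1 <= INR (S j).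
Proof. assert (h := pos_INR j); rewrite S_INR; lra. Qed.

(** No majorant here is uniform on all of (-1, oo), so the series is differentiated on (d - 1, oo)
    with d chosen from x. *)
Lemma is_derive_ln_Gamma_root (x : R) : -1 < x ->
  is_derive (fun y => ln (Gamma_root y)) x (kernel_series 1 x).
Proof.
intros hx; destruct (subinterval_radius_exists x hx) as [d [hd hdx]].
assert (hF : is_derive (fun y => ln (Gamma_root y) + euler_gamma) x (kernel_series 1 x)).
{ apply (is_derive_series (fun j z => / INR (S j) - kernel_integral 0 (INR (S j)) z)
    (fun j => kernel_integral 1 (INR (S j)))
    (fun j z => - INR 2 * kernel_integral 2 (INR (S j)) z)
    (fun j => INR 2 * series_majorant 2 d j) _ _ (d - 1)); auto.
  - intros j z hz.
    replace (kernel_integral 1 (INR (S j)) z) with (0 - (- INR 1 * kernel_integral 1 (INR (S j)) z))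
      by (simpl; ring).
    apply (is_derive_minus (K := R_AbsRing) (V := R_NormedModule));
      [apply (is_derive_const (K := R_AbsRing) (V := R_NormedModule))|].
    apply is_derive_kernel_integral; [apply INR_succ_ge_1|lra].
  - intros j z hz; apply is_derive_kernel_integral; [apply INR_succ_ge_1|lra].
  - intros j z hz; destruct (kernel_integral_le_majorant 1 j z d hd ltac:(lra)) as [h1 h2].
    assert (h3 := pos_INR 2).
    rewrite Rabs_mult, Rabs_Ropp, !Rabs_pos_eq by lra.
    apply Rmult_le_compat_l; lra.
  - apply (ex_series_scal_l (K := R_AbsRing) (V := R_NormedModule) (INR 2)).
    apply ex_series_majorant.
  - intros z hz; apply ln_Gamma_root_series; lra.
  - intros z hz; apply kernel_series_correct; lra. }
apply is_derive_ext with (fun y => (ln (Gamma_root y) + euler_gamma) - euler_gamma).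
{ intros y; simpl; ring. }
replace (kernel_series 1 x) with (kernel_series 1 x - 0) by ring.
apply (is_derive_minus (K := R_AbsRing) (V := R_NormedModule)); auto.
apply (is_derive_const (K := R_AbsRing) (V := R_NormedModule)).
Qed.

Lemma is_derive_kernel_series (n : nat) (x : R) : -1 < x ->
  is_derive (kernel_series (S n)) x (- INR (S (S n)) * kernel_series (S (S n)) x).
Proof.
intros hx; destruct (subinterval_radius_exists x hx) as [d [hd hdx]].
set (k := INR (S (S n))); set (k' := INR (S (S (S n)))).
assert (hk : 0 <= k) by apply pos_INR; assert (hk' : 0 <= k') by apply pos_INR.
apply (is_derive_series (fun j => kernel_integral (S n) (INR (S j)))
    (fun j z => - k * kernel_integral (S (S n)) (INR (S j)) z)
    (fun j z => - k * (- k' * kernel_integral (S (S (S n))) (INR (S j)) z))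
    (fun j => k * k' * series_majorant (S (S (S n))) d j)
    (kernel_series (S n)) (fun x => - k * kernel_series (S (S n)) x) (d - 1)); auto.
- intros j z hz; apply is_derive_kernel_integral; [apply INR_succ_ge_1|lra].
- intros j z hz; apply is_derive_scal, is_derive_kernel_integral; [apply INR_succ_ge_1|lra].
- intros j z hz; destruct (kernel_integral_le_majorant (S (S n)) j z d hd ltac:(lra)) as [h1 h2].
  rewrite !Rabs_mult, !Rabs_Ropp, !Rabs_pos_eq by lra.
  rewrite <- Rmult_assoc; apply Rmult_le_compat_l; nra.
- apply (ex_series_scal_l (K := R_AbsRing) (V := R_NormedModule) (k * k')).
  apply ex_series_majorant.
- intros z hz; apply kernel_series_correct; lra.
- intros z hz; apply (is_series_scal_l (K := R_AbsRing) (V := R_NormedModule) (- k)).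
  apply kernel_series_correct; lra.
Qed.

(** The n-th derivative of the logarithm of the ratio in closed form, with (-1)^n factored out so
    that only the sign of the bracket remains to be settled. *)
Definition log_ratio_derivative (alpha : R) (n : nat) (x : R) : R :=
  match n with
  | O => alpha * ln (x + 1) - ln (Gamma_root x)
  | S m => (-1) ^ n * (INR (fact n) * kernel_series n x - alpha * INR (fact m) / (x + 1) ^ n)
  end.

Lemma is_derive_log_ratio (alpha : R) (n : nat) (x : R) : -1 < x ->
  is_derive (log_ratio_derivative alpha n) x (log_ratio_derivative alpha (S n) x).
Proof.
intros hx; destruct n as [|n].
- unfold log_ratio_derivative.
  replace ((-1) ^ 1 * _) with (alpha * (1 / (x + 1)) - kernel_series 1 x) by (simpl; field; lra).
  apply (is_derive_minus (K := R_AbsRing) (V := R_NormedModule)).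
  + apply is_derive_scal; auto_derive; [lra|field; lra].
  + apply is_derive_ln_Gamma_root, hx.
- unfold log_ratio_derivative.
  replace ((-1) ^ S (S n) * _) with ((-1) ^ S n *
    (INR (fact (S n)) * (- INR (S (S n)) * kernel_series (S (S n)) x)
     - (- INR (S n) * alpha * INR (fact n) / (x + 1) ^ S (S n)))).
  + apply is_derive_scal.
    apply (is_derive_minus (K := R_AbsRing) (V := R_NormedModule)).
    * apply is_derive_scal, is_derive_kernel_series, hx.
    * evar_last; [auto_derive; [apply (pow_nonzero _ (S n)); lra|reflexivity]|].
      simpl Nat.pred; simpl pow.
      change (match n with 0%nat => 1 | S _ => INR n + 1 end) with (INR (S n)).
      field; split; try lra; apply pow_nonzero; lra.
  + rewrite (fact_simpl (S n)), (fact_simpl n), !mult_INR.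
    simpl pow; field; split; try lra; apply pow_nonzero; lra.
Qed.

(** * The bound on tau and the telescoping sum *)

Lemma tau_pow (n : nat) (t : R) : 0 < t ->
  tau (INR n) t = / INR n * (t - (t + INR n + 1) * (t / (t + 1)) ^ S n).
Proof.
intros ht; unfold tau; rewrite <- S_INR, Rpower_pow; [reflexivity|].
apply Rdiv_lt_0_compat; lra.
Qed.

(** A crude bound, enough for the supremum to exist. If t <= n, dropping the power term gives tau <=
    t / n; if t > n, Bernoulli's inequality for (1 - 1 / (t + 1))^(n+1) gives tau <= (n + 1) / (t +
    1). *)
Lemma tau_le_1 (n : nat) (t : R) : (1 <= n)%nat -> 0 < t -> tau (INR n) t <= 1.
Proof.
intros hn ht; rewrite tau_pow by auto.
assert (hn1 : 1 <= INR n) by (apply (le_INR 1); auto).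
set (r := t / (t + 1)).
assert (hr : 0 < r) by (apply Rdiv_lt_0_compat; lra).
assert (hr1 : r = 1 - / (t + 1)) by (unfold r; field; lra).
assert (bern : forall k, 1 - INR k * / (t + 1) <= r ^ k).
{ assert (hi : 0 < / (t + 1)) by (apply Rinv_0_lt_compat; lra).
  induction k as [|k IH]; [simpl; lra|].
  assert (hk := pos_INR k); rewrite S_INR; simpl pow.
  apply Rmult_le_compat_l with (r := r) in IH; [|lra].
  rewrite hr1 in IH at 1.
  assert (0 <= INR k * (/ (t + 1) * / (t + 1))) by (apply Rmult_le_pos; nra).
  nra. }
specialize (bern (S n)).
assert (hp := pow_lt r (S n) hr).
rewrite S_INR in bern.
apply Rmult_le_reg_l with (INR n); [lra|].
rewrite <- Rmult_assoc, Rinv_r, Rmult_1_l by lra.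
destruct (Rle_lt_dec t (INR n)) as [h|h]; [nra|].
apply Rmult_le_compat_l with (r := t + INR n + 1) in bern; [|lra].
replace ((t + INR n + 1) * (1 - (INR n + 1) * / (t + 1))) with
  (t - INR n * ((INR n + 1) / (t + 1))) in bern by (field; lra).
assert ((INR n + 1) / (t + 1) <= 1) by (apply Rle_div_l; lra).
nra.
Qed.

Definition telescoping_term (n : nat) (t : R) : R := (t + INR n) / (INR n * t ^ S n).

Lemma telescoping_term_diff (n : nat) (t tau0 : R) : (1 <= n)%nat -> 0 < t ->
  tau (INR n) t <= tau0 ->
  telescoping_term n t - telescoping_term n (t + 1) <= (1 + tau0) * / t ^ S n.
Proof.
intros hn ht; rewrite tau_pow by auto; intros h.
assert (hn1 : 1 <= INR n) by (apply (le_INR 1); auto).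
assert (hp := pow_lt t (S n) ht).
assert (hp1 := pow_lt (t + 1) (S n) ltac:(lra)).
apply Rmult_le_compat_r with (r := / t ^ S n) in h.
2:{ left; apply Rinv_0_lt_compat, hp. }
unfold Rdiv in h; rewrite Rpow_mult_distr, pow_inv in h.
unfold telescoping_term.
replace ((t + INR n) / (INR n * t ^ S n) - (t + 1 + INR n) / (INR n * (t + 1) ^ S n))
  with (/ INR n * (t - (t + INR n + 1) * (t ^ S n * / (t + 1) ^ S n)) * / t ^ S n
        + / t ^ S n) by (field; lra).
lra.
Qed.

Definition telescoping_integral (n : nat) (x c : R) : R :=
  RInt (fun u => u ^ n * telescoping_term n (c + x * u)) 0 1.

Lemma ex_RInt_telescoping (n : nat) (x c : R) : (1 <= n)%nat -> 1 <= c -> -1 < x ->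
  ex_RInt (fun u => u ^ n * telescoping_term n (c + x * u)) 0 1.
Proof.
intros hn hc hx; apply ex_RInt_01; intros u hu.
assert (h := kernel_denom_pos c x u hc hx hu).
assert (hn1 : 1 <= INR n) by (apply (le_INR 1); auto).
apply (ex_derive_continuous (V := R_NormedModule)).
unfold telescoping_term; auto_derive.
apply Rmult_integral_contrapositive_currified; [lra|].
apply (pow_nonzero _ (S n)); lra.
Qed.

Lemma telescoping_integral_1 (n : nat) (x : R) : (1 <= n)%nat -> -1 < x ->
  telescoping_integral n x 1 = / (INR n * (x + 1) ^ n).
Proof.
intros hn hx; apply (is_RInt_unique (V := R_CompleteNormedModule)).
assert (hn1 : 1 <= INR n) by (apply (le_INR 1); auto).
replace (/ (INR n * (x + 1) ^ n)) with
  (1 ^ S n / (INR n * (1 + x * 1) ^ n) - 0 ^ S n / (INR n * (1 + x * 0) ^ n)).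
2:{ rewrite pow1, pow_i by lia.
    replace (1 + x * 1) with (x + 1) by ring.
    unfold Rdiv; ring. }
apply (is_RInt_derive (V := R_CompleteNormedModule)
  (fun u => u ^ S n / (INR n * (1 + x * u) ^ n)));
  intros u hu; rewrite Rmin_left, Rmax_right in hu by lra;
  assert (h := kernel_denom_pos 1 x u ltac:(lra) hx hu).
- evar_last.
  + auto_derive; [|reflexivity].
    apply Rmult_integral_contrapositive_currified; [lra|apply pow_nonzero; lra].
  + destruct n as [|n]; [lia|].
    unfold telescoping_term; simpl Nat.pred.
    change (match S n with 0%nat => 1 | S _ => INR (S n) + 1 end) with (INR (S n) + 1).
    simpl pow; field; repeat split; try lra; apply pow_nonzero; lra.
- apply (ex_derive_continuous (V := R_NormedModule)).
  unfold telescoping_term; auto_derive.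
  apply Rmult_integral_contrapositive_currified; [lra|].
  apply (pow_nonzero _ (S n)); lra.
Qed.

(** Removes the far end of the telescoping sum. Here t = c + x u >= c - 1 >= 1, so t and n are both
    at most n t^n and g(t) <= 2 / t. *)
Lemma telescoping_integral_le (n : nat) (x c : R) : (1 <= n)%nat -> 2 <= c -> -1 < x ->
  telescoping_integral n x c <= 2 / (c - 1).
Proof.
intros hn hc hx; unfold telescoping_integral.
assert (hn1 : 1 <= INR n) by (apply (le_INR 1); auto).
replace (2 / (c - 1)) with (RInt (fun _ => 2 / (c - 1)) 0 1).
2:{ rewrite RInt_const; unfold scal; simpl; unfold mult; simpl; ring. }
apply RInt_le; [lra|apply ex_RInt_telescoping; auto; lra|apply ex_RInt_const|].
intros u hu; set (t := c + x * u).
assert (ht : c - 1 <= t) by (unfold t; nra).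
assert (h1 : 0 <= u ^ n <= 1).
{ split; [apply pow_le; lra|rewrite <- (pow1 n); apply pow_incr; lra]. }
assert (h2 : 0 <= telescoping_term n t <= 2 / (c - 1)); [|nra].
assert (hp := pow_lt t n ltac:(lra)).
unfold telescoping_term; split.
- left; apply Rdiv_lt_0_compat; [lra|].
  apply Rmult_lt_0_compat; [lra|apply pow_lt; lra].
- apply Rle_trans with (2 / t).
  2:{ apply Rmult_le_compat_l; [lra|apply Rinv_le_contravar; lra]. }
  apply Rle_div_l; [apply Rmult_lt_0_compat; [lra|apply pow_lt; lra]|].
  replace (2 / t * (INR n * t ^ S n)) with (2 * INR n * t ^ n) by (simpl; field; lra).
  assert (t <= t ^ n).
  { destruct n as [|n]; [lia|]; simpl.
    assert (1 <= t ^ n) by (apply pow_R1_Rle; lra); nra. }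
  nra.
Qed.

Lemma telescoping_integral_diff (n : nat) (x c tau0 : R) : (1 <= n)%nat -> 1 <= c -> -1 < x ->
  (forall t, 0 < t -> tau (INR n) t <= tau0) ->
  telescoping_integral n x c - telescoping_integral n x (c + 1) <= (1 + tau0) * kernel_integral n c x.
Proof.
intros hn hc hx htau; unfold telescoping_integral, kernel_integral.
rewrite <- (RInt_minus (V := R_CompleteNormedModule)) by (apply ex_RInt_telescoping; auto; lra).
rewrite <- (RInt_scal (V := R_CompleteNormedModule)) by (apply ex_RInt_kernel; auto).
apply RInt_le; [lra| | |].
- apply (ex_RInt_minus (V := R_CompleteNormedModule)); apply ex_RInt_telescoping; auto; lra.
- apply (ex_RInt_scal (V := R_CompleteNormedModule)), ex_RInt_kernel; auto.
- intros u hu; unfold minus, plus, opp, scal; simpl; unfold mult; simpl.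
  assert (h := kernel_denom_pos c x u hc hx ltac:(lra)).
  assert (h1 := telescoping_term_diff n _ tau0 hn h (htau _ h)).
  assert (h2 : 0 <= u ^ n) by (apply pow_le; lra).
  replace (c + 1 + x * u) with (c + x * u + 1) by ring.
  unfold kernel, Rdiv.
  apply Rmult_le_compat_l with (r := u ^ n) in h1; [|exact h2].
  lra.
Qed.

Lemma kernel_series_lower_bound (n : nat) (x tau0 : R) : -1 < x ->
  (forall t, 0 < t -> tau (INR (S n)) t <= tau0) ->
  / (INR (S n) * (x + 1) ^ S n) <= (1 + tau0) * kernel_series (S n) x.
Proof.
intros hx htau.
assert (hn : (1 <= S n)%nat) by lia.
assert (hsum : forall N,
  telescoping_integral (S n) x 1 - telescoping_integral (S n) x (INR (S (S N))) <=
  (1 + tau0) * sum_n (fun j => kernel_integral (S n) (INR (S j)) x) N).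
{ induction N as [|N IH].
  - rewrite sum_O; apply telescoping_integral_diff; auto; simpl; lra.
  - assert (e : sum_n (fun j => kernel_integral (S n) (INR (S j)) x) (S N) =
      sum_n (fun j => kernel_integral (S n) (INR (S j)) x) N + kernel_integral (S n) (INR (S (S N))) x)
      by apply (sum_Sn (G := R_AbelianMonoid)).
    rewrite e, (S_INR (S (S N))).
    assert (h := telescoping_integral_diff (S n) x (INR (S (S N))) tau0 hn (INR_succ_ge_1 _) hx htau).
    lra. }
rewrite <- telescoping_integral_1 by auto.
(* The partial sum runs over c = 1, ..., N + 1, leaving the integral at c = N + 2, which is at most
   2 / (N + 1); this error is added on the right before passing to the limit. *)
assert (hl : is_lim_seq (fun N => (1 + tau0) * sum_n (fun j => kernel_integral (S n) (INR (S j)) x) N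
   + 2 * / INR (S N)) ((1 + tau0) * kernel_series (S n) x + 2 * 0)).
{ apply is_lim_seq_plus'; apply is_lim_seq_mult'; try apply is_lim_seq_const.
  - exact (kernel_series_correct n x hx).
  - apply is_lim_seq_inv_INR_succ. }
rewrite Rmult_0_r, Rplus_0_r in hl.
refine (is_lim_seq_le (fun _ => telescoping_integral (S n) x 1) _ _ _ _ (is_lim_seq_const _) hl).
intros N; specialize (hsum N).
assert (hN := INR_succ_ge_1 N).
assert (h := telescoping_integral_le (S n) x (INR (S (S N))) hn).
rewrite (S_INR (S N)) in h, hsum.
replace (INR (S N) + 1 - 1) with (INR (S N)) in h by ring.
unfold Rdiv in h; specialize (h ltac:(lra) hx); lra.
Qed.

Theorem theorem4 :
  (exists tau0 : R, is_lub tau_values tau0) /\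
  (forall tau0 : R, is_lub tau_values tau0 ->
     0 < tau0 /\ 1 / (1 + tau0) < 1 /\
     forall alpha : R, alpha <= 1 / (1 + tau0) ->
       log_completely_monotonic (Finite (-1)) p_infty
         (fun x : R => Rpower (x + 1) alpha / Gamma_root x)).
Proof.
split.
{ destruct (completeness tau_values) as [tau0 h].
  - exists 1; intros v [s [t [hs [ht ->]]]]; apply tau_le_1; auto.
  - exists (tau (INR 1) 1), 1%nat, 1; repeat split; auto; lra.
  - exists tau0; exact h. }
intros tau0 [hub _].
assert (htau : forall n t, (1 <= n)%nat -> 0 < t -> tau (INR n) t <= tau0).
{ intros n t hn ht; apply hub; exists n, t; auto. }
assert (h0 : 0 < tau0).
{ apply Rlt_le_trans with (2 := htau 1%nat 1 ltac:(lia) ltac:(lra)).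
  rewrite tau_pow by lra; simpl; lra. }
split; [exact h0|split].
{ apply Rlt_div_l; lra. }
intros alpha halpha x hx _; simpl in hx.
set (D := log_ratio_derivative alpha).
assert (hD : forall n z, -1 < z -> is_derive (D n) z (D (S n) z))
  by (intros; apply is_derive_log_ratio; auto).
assert (hpos : forall y, 0 < Gamma_root y).
{ intros y; unfold Gamma_root; destruct (Req_dec_T y 0); apply exp_pos. }
(* True for every real y, even where [ln (y + 1)] is a default value, because [Rpower] is an
   exponential by definition. Derivatives can therefore be transferred without restricting to a
   neighbourhood. *)
assert (hln : forall y, ln (Rpower (y + 1) alpha / Gamma_root y) = D 0%nat y).
{ intros y; rewrite ln_div by (auto; apply exp_pos).
  unfold Rpower; rewrite ln_exp; reflexivity. }
assert (hf : forall y, 0 < Rpower (y + 1) alpha / Gamma_root y).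
{ intros y; apply Rdiv_lt_0_compat; [apply exp_pos|auto]. }
split; [apply hf|split].
- intros n; apply ex_derive_n_ext with (fun y => exp (D 0%nat y)).
  { intros y; rewrite <- hln; apply exp_ln, hf. }
  apply (n_smooth_above_ex_derive_n (-1)); [|exact hx].
  apply n_smooth_above_exp, derivative_sequence_smooth, hD.
- intros n hn; rewrite (Derive_n_ext _ _ n x hln).
  rewrite (derivative_sequence_Derive_n (-1) D hD) by exact hx.
  destruct n as [|n]; [lia|].
  change (D (0 + S n)%nat x) with (log_ratio_derivative alpha (S n) x).
  unfold log_ratio_derivative.
  rewrite <- Rmult_assoc, <- Rpow_mult_distr.
  replace (-1 * -1) with 1 by ring; rewrite pow1, Rmult_1_l.
  assert (hb := kernel_series_lower_bound n x tau0 hx ltac:(intros; apply htau; auto; lia)).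
  assert (hn1 := INR_succ_ge_1 n).
  assert (hp := pow_lt (x + 1) (S n) ltac:(lra)).
  assert (hfact := lt_0_INR _ (lt_O_fact n)).
  rewrite fact_simpl, mult_INR.
  rewrite Rinv_mult in hb.
  assert (hq := Rinv_0_lt_compat _ hp).
  (* With n + 1 as the order, this factor isolates (n + 1) times the series on one side and 1 / (1 +
     tau0), the bound on alpha, on the other. *)
  apply Rmult_le_compat_l with (r := INR (S n) / (1 + tau0)) in hb.
  2:{ left; apply Rdiv_lt_0_compat; lra. }
  replace (INR (S n) / (1 + tau0) * (/ INR (S n) * / (x + 1) ^ S n)) with
    (1 / (1 + tau0) * / (x + 1) ^ S n) in hb by (field; lra).
  replace (INR (S n) / (1 + tau0) * ((1 + tau0) * kernel_series (S n) x)) with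
    (INR (S n) * kernel_series (S n) x) in hb by (field; lra).
  apply Rmult_le_compat_r with (r := / (x + 1) ^ S n) in halpha; [|lra].
  replace (INR (S n) * INR (fact n) * kernel_series (S n) x - alpha * INR (fact n) / (x + 1) ^ S n)
    with (INR (fact n) * (INR (S n) * kernel_series (S n) x - alpha * / (x + 1) ^ S n))
    by (unfold Rdiv; ring).
  apply Rmult_le_pos; lra.
Qed.
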